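(* Let $A$ be a finite abelian group and $G$ a totally pseudo-unramified finite group acting on $A$ by automorphisms. Then the semidirect product $A\rtimes G$ (with $A$ normal) is totally pseudo-unramified.
   Context: All groups are finite, characters are complex. A character is multiplicity free if every irreducible character occurs in it with multiplicity at most $1$. A finite group $G$ is pseudo-unramified over a nontrivial abelian normal subgroup $N$ if for every $\mu\in\mathrm{Irr}(N)$ there exists $\chi\in\mathrm{Irr}(G)$ with $\langle\chi|_N,\mu\rangle>0$ such that $\chi|_N$ is multiplicity free. A finite group $G$ is totally pseudo-unramified (recursively) if it is abelian or there exists a nontrivial abelian normal subgroup $N$ such that $G$ is pseudo-unramified over $N$ and $G/N$ is totally pseudo-unramified. *)

(* Defs.v *)
From mathcomp Require Import all_boot all_order all_fingroup all_algebra.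
From mathcomp Require Import all_solvable all_field all_character.

Set Implicit Arguments.
Unset Strict Implicit.
Unset Printing Implicit Defensive.

Import Order.TTheory GroupScope GRing.Theory Num.Theory.
Local Open Scope ring_scope.

(* Complex characters of finite groups take their values in algC, so 'CF(H)
   and irr H are the usual complex class functions and characters. *)
Definition multiplicity_free (gT : finGroupType) (H : {group gT})
    (phi : 'CF(H)) : Prop :=
  forall i : Iirr H, '[phi, 'chi_i] <= 1.

Definition pseudo_unramified (gT : finGroupType) (G N : {group gT}) : Prop :=
  [/\ N <| G, abelian N, N :!=: 1%g &
      forall m : Iirr N, exists i : Iirr G,
        0 < '['Res[N] 'chi[G]_i, 'chi[N]_m]
        /\ multiplicity_free ('Res[N] 'chi[G]_i)].

(* The ambient type is an index because G / N lives in coset_of N.  Being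
   inductive, the predicate only allows finitely many quotient steps, ending
   with an abelian group. *)
Inductive totally_pseudo_unramified :
    forall gT : finGroupType, {group gT} -> Prop :=
| tpu_abelian (gT : finGroupType) (G : {group gT}) :
    abelian G -> totally_pseudo_unramified G
| tpu_quotient (gT : finGroupType) (G N : {group gT}) :
    pseudo_unramified G N -> totally_pseudo_unramified (G / N)%G ->
    totally_pseudo_unramified G.

(* Main.v *)
(** Let H be the semidirect product of the abelian normal subgroup A by G.
    The permutation character of H on the cosets of G restricts to the regular
    character of A, which is multiplicity free because A is abelian. Hence
    every irreducible character of A lies under some constituent of this
    permutation character, and that constituent is multiplicity free on A.
    So H is pseudo-unramified over A with quotient isomorphic to G, unless
    A = 1, in which case H itself is isomorphic to G. *)
Require Import Defs.
From mathcomp Require Import all_boot all_order all_fingroup all_algebra.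
From mathcomp Require Import all_solvable all_field all_character.

Set Implicit Arguments.
Unset Strict Implicit.
Unset Printing Implicit Defensive.

Import Order.TTheory GroupScope GRing.Theory Num.Theory.
Local Open Scope ring_scope.

(** At the identity the induced character has value |H : K| = |A|. A nontrivial element of [A] has
    all its [H]-conjugates in [A], hence none in [K], so the induced character vanishes there. *)
Lemma cfRes_Ind_compl_cfun1 (gT : finGroupType) (H A K : {group gT}) :
  A ><| K = H -> 'Res[A] ('Ind[H, K] 1) = cfReg A.
Proof.
move=> defH; have [nsAH sKH _ _ tiAK] := sdprod_context defH.
have [sAH nAH] := andP nsAH.
apply/cfun_inP=> a Aa; rewrite cfResE // cfRegE.
have [-> | nta] := eqVneq a 1%g.
  by rewrite cfInd1 // cfun11 mulr1 -divgS // -(sdprod_card defH) mulnK.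
rewrite cfIndE // big1 ?mulr0 // => y Hy; rewrite cfun1E.
have [Kay | //] := boolP ((a ^ y)%g \in K).
have: (a ^ y)%g \in A :&: K by rewrite inE Kay memJ_norm ?(subsetP nAH) ?Aa.
by rewrite tiAK inE conjg_eq1 (negPf nta).
Qed.

Lemma pseudo_unramified_sdprod (gT : finGroupType) (H A K : {group gT}) :
  A ><| K = H -> abelian A -> A :!=: 1%g -> pseudo_unramified H A.
Proof.
move=> defH abA ntA; have [nsAH _ _ _ _] := sdprod_context defH.
split=> // m; set phi := 'Ind[H, K] 1.
have Nphi : phi \is a character by rewrite cfInd_char ?cfun1_char.
have phiA1 j : '['Res[A] phi, 'chi_j] = 1.
  have /char_abelianP/(_ j)/lin_char1 chi1 := abA.
  rewrite (cfRes_Ind_compl_cfun1 defH) cfReg_sum cfdot_suml (bigD1 j) //=.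
  rewrite cfdotZl cfnorm_irr chi1 mulr1 big1 ?addr0 // => k /negPf k'j.
  by rewrite cfdotZl cfdot_irr k'j mulr0.
have /existsP[i /andP[phi_i i_m]] :
  [exists i, (i \in irr_constt phi) && (m \in irr_constt ('Res[A] 'chi_i))].
(* Otherwise, by Frobenius reciprocity, every term of the expansion of ['[phi, 'Ind 'chi_m]] over
   [irr H] vanishes, although this product is 1. *)
- apply: contraNT (oner_neq0 algC) => /existsPn no_i.
  rewrite -(phiA1 m) cfdot_Res_l cfdot_sum_irr big1 // => i _.
  have:= no_i i; rewrite -constt_Ind_Res !irr_consttE negb_and !negbK.
  by case/orP=> /eqP->; rewrite ?conjC0 ?mul0r ?mulr0.
exists i; split=> [|j].
  rewrite lt_def -irr_consttE i_m natr_ge0 //.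
  by rewrite Cnat_cfdot_char ?cfRes_char ?irr_char.
by rewrite -(phiA1 j) cfdot_Res_ge_constt.
Qed.

Lemma pseudo_unramified_injm (gT rT : finGroupType) (G N : {group gT})
    (f : {morphism G >-> rT}) :
  'injm f -> pseudo_unramified G N -> pseudo_unramified (f @* G) (f @* N).
Proof.
move=> injf [nsNG abN ntN puGN]; have sNG := normal_sub nsNG.
have isoG : isom G (f @* G) f by apply/isomP.
have isoN : isom N (f @* N) (restrm sNG f).
  by apply/isomP; rewrite injm_restrm // morphim_restrm setIid.
split; rewrite ?morphim_normal ?morphim_abelian ?morphim_injm_eq1 //.
(* Transport of characters along [f] commutes with restriction and is an isometry, so multiplicities
   can be computed in [N]. *)
have resE i k : '['Res[f @* N] 'chi_(isom_Iirr isoG i), 'chi_k]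
    = '['Res[N] 'chi_i, 'chi_(isom_Iirr (isom_sym isoN) k)].
  rewrite isom_IirrE (cfResIsom isoG isoN) // -{1}[k](isom_IirrKV isoN).
  by rewrite (isom_IirrE isoN) cfIsom_iso.
move=> m; have [i [i_m i_mf]] := puGN (isom_Iirr (isom_sym isoN) m).
by exists (isom_Iirr isoG i); split=> [|j]; rewrite resE.
Qed.

(** Induction on the derivation, with the target group and its type kept general: the quotient step
    applies the hypothesis to the isomorphism that [f] induces from [G / N] onto
    [f @* G / f @* N]. *)
Lemma totally_pseudo_unramified_isog (gT rT : finGroupType) (G : {group gT})
    (H : {group rT}) :
  G \isog H -> totally_pseudo_unramified G -> totally_pseudo_unramified H.
Proof.
move=> isoGH tpuG.
elim: tpuG rT H isoGH => {gT G} [gT G abG | gT G N puGN _ IH] rT H isoGH.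
  by apply: tpu_abelian; rewrite -(isog_abelian isoGH).
have [f injf defH] := isogP isoGH; have [nsNG _ _ _] := puGN.
have puH := pseudo_unramified_injm injf puGN.
have -> : H = (f @* G)%G by apply: val_inj.
apply: (tpu_quotient puH); apply: IH.
apply/isogP; exists (quotm_morphism f nsNG); first exact: injm_quotm.
exact: morphim_quotm.
Qed.

Theorem corollary4p10 (gT aT : finGroupType) (G : {group gT}) (A : {group aT})
    (to : groupAction G A) :
  abelian A -> totally_pseudo_unramified G ->
  totally_pseudo_unramified [set: sdprod_by to]%G.
Proof.
move=> abA tpuG; have defH := sdprod_sdpair to.
have isoG : G \isog sdpair2 to @* G by rewrite sub_isog ?injm_sdpair2.
have tpuK := totally_pseudo_unramified_isog isoG tpuG.
have [A1 | ntA] := eqVneq (sdpair1 to @* A) 1%g.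
  have -> // : [set: sdprod_by to]%G = (sdpair2 to @* G)%G.
  by apply: val_inj; rewrite /= -defH A1 sdprod1g.
apply: (@tpu_quotient _ _ (sdpair1 to @* A)%G).
  by apply: pseudo_unramified_sdprod defH _ ntA; rewrite morphim_abelian.
exact: totally_pseudo_unramified_isog (sdprod_isog defH) tpuK.
Qed.
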